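(* Let $G$ be a simple undirected graph on $n$ vertices that has a Hamiltonian path. If $n$ is even then $\mathcal{E}(G)\ge n$. If $n$ is odd then $\mathcal{E}(G)\ge\sqrt{n^2-1}$.
   Context: If $\lambda_1,\dots,\lambda_n$ are the eigenvalues of the adjacency matrix of $G$, the energy of $G$ is $\mathcal{E}(G)=\sum_{k=1}^n|\lambda_k|$. A Hamiltonian path is a path in $G$ visiting every vertex exactly once. *)

(* Defs.v *)
From mathcomp Require Import all_boot all_order all_algebra.

Set Implicit Arguments.
Unset Strict Implicit.
Unset Printing Implicit Defensive.

Import GRing.Theory Num.Theory.
Local Open Scope ring_scope.

(* A simple undirected graph on a finite vertex type T is given by a symmetric
   irreflexive relation e : rel T; its number of vertices is #|T|.
   Eigenvalues are taken in an arbitrary numClosedFieldType C, so that R[i] for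
   a real closed field R, as well as algC, are instances. *)

Definition adjacency_matrix (C : numClosedFieldType) (T : finType)
    (e : rel T) : 'M[C]_#|T| :=
  \matrix_(i, j) (e (enum_val i) (enum_val j))%:R.

(* With algebraic multiplicity: char_poly A is monic, hence equal to
   \prod_(z <- eigenvalues A) ('X - z%:P). *)
Definition eigenvalues (C : numClosedFieldType) (n : nat) (A : 'M[C]_n) :
    seq C :=
  sval (closed_field_poly_normal (char_poly A)).

Definition energy (C : numClosedFieldType) (T : finType) (e : rel T) : C :=
  \sum_(z <- eigenvalues (adjacency_matrix C e)) `|z|.

Definition has_hamiltonian_path (T : finType) (e : rel T) : Prop :=
  exists p : seq T, [/\ uniq p, forall x : T, x \in p & sorted e p].

(* Main.v *)
(* For a Hermitian matrix [A] and a contraction [M], diagonalizing [A] in an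
   orthonormal basis shows that [|tr (M A)|] is at most the sum of the absolute
   values of the eigenvalues of [A].  When [M] is nonnegative and supported on
   edges, [tr (M A)] is the sum of the entries of [M]; by Schur's test, [M] is a
   contraction as soon as [M w <= w] for some positive vector [w].  On a
   Hamiltonian path with [n] even, [M] is the perfect matching made of every
   other edge.  With [n] odd, the weights on the path edges are chosen so that
   the row sums of [M] alternate between [sqrt ((n - 1) / (n + 1))] and its
   inverse; their total is [sqrt (n ^ 2 - 1)]. *)
Require Import Defs.
From mathcomp Require Import all_boot all_order all_algebra.
From mathcomp Require Import ring.

Set Implicit Arguments.
Unset Strict Implicit.
Unset Printing Implicit Defensive.

Import Order.TTheory GRing.Theory Num.Theory.
Local Open Scope ring_scope.

Lemma char_poly_uconj (R : comUnitRingType) (n : nat) (P A : 'M[R]_n) :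
  P \in unitmx -> char_poly (invmx P *m A *m P) = char_poly A.
Proof.
move=> Pu; pose Q := map_mx (@polyC R) P; pose Q' := map_mx (@polyC R) (invmx P).
have QQ : Q' *m Q = 1%:M by rewrite -map_mxM mulVmx // map_mx1.
have -> : char_poly (invmx P *m A *m P) = \det (Q' *m char_poly_mx A *m Q).
  rewrite /char_poly /char_poly_mx !map_mxM mulmxBr mulmxBl; congr (\det (_ - _)).
  by rewrite scalar_mxC -mulmxA QQ mulmx1.
by rewrite !det_mulmx mulrAC -det_mulmx QQ det1 mul1r.
Qed.

(** Write [x i = w i * z i] and bound each [z i * z j] by the mean of the two squares. By symmetry
    of [M] the two halves agree, and row [i] collects [w i * z i ^+ 2] times the [i]-th entry of
    [M w]. *)
Lemma schur_test (C : numFieldType) (n : nat) (M : 'M[C]_n) (w x : 'I_n -> C) :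
    (forall i j, 0 <= M i j) -> (forall i j, M i j = M j i) ->
    (forall i, 0 < w i) -> (forall i, \sum_j M i j * w j <= w i) ->
    (forall i, x i \is Num.real) ->
  \sum_i \sum_j M i j * (x i * x j) <= \sum_i x i ^+ 2.
Proof.
move=> M0 Msym w0 Mw xr.
pose z i := x i / w i.
have w_neq0 i : w i != 0 by rewrite gt_eqF.
have wr i : w i \is Num.real by rewrite gtr0_real.
have zr i : z i \is Num.real by rewrite rpred_div.
have xE i : x i = w i * z i by rewrite mulrC divfK.
pose S := \sum_i \sum_j M i j * w i * w j * z i ^+ 2.
have S_le : S <= \sum_i x i ^+ 2.
  apply: ler_sum => i _.
  have -> : \sum_j M i j * w i * w j * z i ^+ 2 =
            (w i * z i ^+ 2) * \sum_j M i j * w j.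
    by rewrite mulr_sumr; apply: eq_bigr => j _; ring.
  have -> : x i ^+ 2 = (w i * z i ^+ 2) * w i by rewrite xE; ring.
  by apply: ler_wpM2l (Mw i); rewrite mulr_ge0 ?(ltW (w0 i)) // real_exprn_even_ge0.
apply: le_trans S_le.
have -> : S = \sum_i \sum_j M i j * w i * w j * ((z i ^+ 2 + z j ^+ 2) / 2).
  have Sswap : S = \sum_i \sum_j M i j * w i * w j * z j ^+ 2.
    rewrite /S exchange_big; apply: eq_bigr => i _; apply: eq_bigr => j _.
    by rewrite Msym; ring.
  have -> : S = (S + S) / 2 by field.
  rewrite {2}Sswap /S -big_split mulr_suml; apply: eq_bigr => i _.
  by rewrite -big_split mulr_suml; apply: eq_bigr => j _ /=; ring.
apply: ler_sum => i _; apply: ler_sum => j _.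
have -> : M i j * (x i * x j) = M i j * w i * w j * (z i * z j).
  by rewrite !xE; ring.
apply: ler_wpM2l; first by rewrite !mulr_ge0 ?(ltW (w0 _)).
exact: real_leif_mean_square.
Qed.

(** [eigenvalues] is a chosen list of roots whose order is unspecified, so the comparison goes
    through the product of the linear factors. *)
Lemma perm_eigenvalues_diag (C : numClosedFieldType) (n : nat)
    (P : 'M[C]_n) (d : 'rV[C]_n) : P \in unitmx ->
  perm_eq (eigenvalues (invmx P *m diag_mx d *m P)) [seq d 0 i | i : 'I_n].
Proof.
move=> Pu; apply: prod_XsubC_eq; rewrite /eigenvalues.
case: closed_field_poly_normal => /= s.
rewrite (monicP (char_poly_monic _)) scale1r => <-.
rewrite char_poly_uconj // char_poly_trig ?diag_mx_is_trig //.
rewrite big_image; apply: eq_bigr => i _.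
by rewrite mxE eqxx mulr1n.
Qed.

(** With [A] diagonalized by a unitary [U], the trace is the sum of the eigenvalues weighted by the
    diagonal entries of [U M U^*]; each such entry has modulus at most 1. *)
Lemma trace_mul_le_eigenvalues (C : numClosedFieldType) (n : nat)
    (A M : 'M[C]_n) (w : 'I_n -> C) :
    A \is hermsymmx ->
    (forall i j, 0 <= M i j) -> (forall i j, M i j = M j i) ->
    (forall i, 0 < w i) -> (forall i, \sum_j M i j * w j <= w i) ->
  `|\tr (M *m A)| <= \sum_(z <- eigenvalues A) `|z|.
Proof.
move=> Aherm M0 Msym w0 Mw.
have /orthomx_spectralP := hermitian_normalmx Aherm.
set U := spectralmx A; set d := spectral_diag A => AE.
have Uu : U \is unitarymx by apply: spectral_unitarymx.
have Uunit := unitarymx_unit Uu.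
rewrite AE (perm_big _ (perm_eigenvalues_diag d Uunit)) big_image /=.
rewrite !mulmxA mxtrace_mulC !mulmxA invmx_unitary //.
apply: le_trans (ler_norm_sum _ _ _) _; apply: ler_sum => i _.
rewrite mul_mx_diag mxE normrM -[leRHS]mul1r ler_wpM2r //.
rewrite mxE.
have -> : \sum_j (U *m M) i j * (map_mx Num.conj U^T) j i =
          \sum_j \sum_k M k j * (U i k * (U i j)^*).
  apply: eq_bigr => j _; rewrite !mxE mulr_suml; apply: eq_bigr => k _.
  by ring.
rewrite exchange_big.
(* Since [M] is nonnegative, moduli may be taken entrywise; this gives the real vector that
   [schur_test] requires, of norm 1 as a row of [U]. *)
apply: le_trans (_ : \sum_k \sum_j M k j * (`|U i k| * `|U i j|) <= _).
  apply: le_trans (ler_norm_sum _ _ _) _; apply: ler_sum => k _.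
  apply: le_trans (ler_norm_sum _ _ _) _; apply: ler_sum => j _.
  by rewrite !normrM norm_conjC (ger0_norm (M0 _ _)).
apply: le_trans (schur_test M0 Msym w0 Mw (fun j => normr_real (U i j))) _.
have /matrixP/(_ i i) := unitarymxP Uu.
rewrite !mxE eqxx mulr1n => <-.
by apply: ler_sum => j _; rewrite !mxE normCK.
Qed.

Lemma adjacency_matrix_hermsym (C : numClosedFieldType) (T : finType)
    (e : rel T) : symmetric e -> adjacency_matrix C e \is hermsymmx.
Proof.
move=> e_sym; apply/is_hermitianmxP/matrixP => i j.
by rewrite expr0 scale1r !mxE e_sym conjC_nat.
Qed.

Lemma sum_weights_le_energy (C : numClosedFieldType) (T : finType) (e : rel T)
    (m : T -> T -> C) (w : T -> C) :
    symmetric e ->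
    (forall x y, 0 <= m x y) -> (forall x y, m x y = m y x) ->
    (forall x y, ~~ e x y -> m x y = 0) ->
    (forall x, 0 < w x) -> (forall x, \sum_y m x y * w y <= w x) ->
  \sum_x \sum_y m x y <= energy C e.
Proof.
move=> e_sym m0 msym me w0 mw.
pose M : 'M[C]_#|T| := \matrix_(i, j) m (enum_val i) (enum_val j).
have trE : \tr (M *m adjacency_matrix C e) = \sum_x \sum_y m x y.
  rewrite [RHS](reindex _ (onW_bij _ (@enum_val_bij T))).
  apply: eq_bigr => i _; rewrite mxE.
  rewrite [RHS](reindex _ (onW_bij _ (@enum_val_bij T))).
  apply: eq_bigr => j _; rewrite !mxE e_sym.
  by have [_|/me->] := boolP (e _ _); rewrite ?mulr1 ?mulr0.
rewrite -trE -[leLHS]ger0_norm; last first.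
  by rewrite trE sumr_ge0 // => x _; rewrite sumr_ge0.
apply: (@trace_mul_le_eigenvalues _ _ _ _ (w \o enum_val)).
- exact: adjacency_matrix_hermsym.
- by move=> i j; rewrite mxE.
- by move=> i j; rewrite !mxE.
- by move=> i /=.
- move=> i /=; apply: le_trans (mw (enum_val i)).
  rewrite [leRHS](reindex _ (onW_bij _ (@enum_val_bij T))).
  by apply: ler_sum => j _; rewrite mxE.
Qed.

Lemma perm_index_enum (T : finType) (p : seq T) :
  uniq p -> (forall x, x \in p) -> perm_eq (index_enum T) p.
Proof.
move=> p_uniq p_full; apply: uniq_perm (index_enum_uniq _) p_uniq _ => x.
by rewrite p_full mem_index_enum.
Qed.

Lemma sum_index (V : nmodType) (T : finType) (p : seq T) (g : nat -> V) :
    uniq p -> (forall x, x \in p) ->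
  \sum_x g (index x p) = \sum_(0 <= a < #|T|) g a.
Proof.
move=> p_uniq p_full.
have p_perm := perm_index_enum p_uniq p_full.
have size_p : size p = #|T|.
  by rewrite -(perm_size p_perm) cardT enumT.
rewrite (perm_big _ p_perm) -size_p.
(* [nth] needs a default element, so an empty [T] is treated apart. *)
have [->|[x0 _]] : p = [::] \/ exists x0, x0 \in p.
- by case: (p) => [|x s]; [left | right; exists x; rewrite mem_head].
- by rewrite big_nil big_geq.
rewrite (big_nth x0) !big_nat; apply: eq_bigr => a /andP[_ a_lt].
by rewrite index_uniq.
Qed.

(* [d a] is the weight of the edge between the vertices of positions [a - 1] and
   [a] on the path, with [0] at the two nonexistent end edges. *)
Lemma hamiltonian_weights_le_energy (C : numClosedFieldType) (T : finType)
    (e : rel T) (d : nat -> C) (w : bool -> C) :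
    symmetric e -> has_hamiltonian_path e ->
    d 0 = 0 -> d #|T| = 0 -> (forall a, (a <= #|T|)%N -> 0 <= d a) ->
    (forall b, 0 < w b) ->
    (forall a, (a < #|T|)%N -> (d a + d a.+1) * w (~~ odd a) <= w (odd a)) ->
  \sum_(0 <= a < #|T|) (d a + d a.+1) <= energy C e.
Proof.
move=> e_sym [p [p_uniq p_full p_sorted]] d0 dn d_ge0 w0 dw.
have size_p : size p = #|T|.
  by rewrite -(perm_size (perm_index_enum p_uniq p_full)) cardT enumT.
have pos_lt x : (index x p < #|T|)%N by rewrite -size_p index_mem.
(* An edge carries the value of [d] at its later endpoint; the two summands make the weight
   symmetric. *)
pose wgt a b := (if b == a.+1 then d b else 0) + (if a == b.+1 then d a else 0).
(* Both neighbours of position [a] have the opposite parity. At the two ends the missing neighbour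
   is harmless because [d] vanishes there. *)
have wgt_row a (u : bool -> C) : (a < #|T|)%N ->
    \sum_(0 <= b < #|T|) wgt a b * u (odd b) = (d a + d a.+1) * u (~~ odd a).
  move=> a_lt; rewrite mulrDl addrC.
  under eq_bigr do rewrite mulrDl.
  rewrite big_split /=; congr (_ + _).
    under eq_bigr do rewrite (fun_if (fun c => c * u _)) mul0r.
    rewrite -big_mkcond big_nat1_eq /=.
    have [->|a_neq] := eqVneq a.+1 #|T|; first by rewrite ltnn dn mul0r.
    by rewrite ltn_neqAle a_neq a_lt.
  case: a a_lt => [|a] a_lt; first by rewrite d0 mul0r big1 // => b _; rewrite mul0r.
  under eq_bigr do rewrite (fun_if (fun c => c * u _)) mul0r eqSS eq_sym.
  by rewrite -big_mkcond big_nat1_eq /= negbK (ltnW a_lt).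
have -> : \sum_(0 <= a < #|T|) (d a + d a.+1) =
          \sum_x \sum_y wgt (index x p) (index y p).
  rewrite -(sum_index (fun a => d a + d a.+1) p_uniq p_full).
  apply: eq_bigr => x _; rewrite (sum_index (wgt (index x p)) p_uniq p_full).
  have := wgt_row _ (fun=> 1) (pos_lt x).
  by rewrite mulr1 => <-; apply: eq_bigr => b _; rewrite mulr1.
have edge x y : index y p = (index x p).+1 -> e x y.
  move=> yx; have y_lt : ((index x p).+1 < size p)%N by rewrite -yx size_p.
  by have /(sortedP x)/(_ _ y_lt) := p_sorted; rewrite -yx !nth_index.
apply: (@sum_weights_le_energy _ _ _ _ (fun x => w (odd (index x p)))) => //.
- move=> x y; rewrite /wgt addr_ge0 //; case: ifP => // _;
    by rewrite d_ge0 // ltnW.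
- by move=> x y; rewrite /wgt addrC.
- move=> x y nexy; rewrite /wgt.
  case: eqP => [/edge|_]; first by rewrite (negPf nexy).
  case: eqP => [/edge|_]; first by rewrite e_sym (negPf nexy).
  by rewrite addr0.
- move=> x.
  rewrite (sum_index (fun b => wgt (index x p) b * w (odd b)) p_uniq p_full).
  by rewrite wgt_row // dw.
Qed.

Lemma sum_alternating (V : nmodType) (k : nat) (u v : V) :
  \sum_(0 <= a < k.*2.+1) (if odd a then u else v) = u *+ k + v *+ k.+1.
Proof.
elim: k => [|k IHk]; first by rewrite big_nat1 mulr0n add0r.
rewrite doubleS big_nat_recr // big_nat_recr //= IHk !odd_double /=.
by rewrite -addrA addrACA -!mulrSr.
Qed.

Theorem theorem3p1 (C : numClosedFieldType) (n : nat) (T : finType)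
    (e : rel T) (e_sym : symmetric e) (e_irr : irreflexive e)
    (card_T : #|T| = n) (ham : has_hamiltonian_path e) :
  (~~ odd n -> n%:R <= energy C e) /\
  (odd n -> sqrtC (n%:R ^+ 2 - 1) <= energy C e).
Proof.
split=> [n_even|n_odd].
  have sum1 a : (odd a)%:R + (odd a.+1)%:R = 1 :> C.
    by rewrite /=; case: (odd a); rewrite ?addr0 ?add0r.
  (* Weight 1 on the edges from position [2i] to [2i + 1]: every row sum is 1, and [d n = 0] because
     [n] is even. *)
  have := @hamiltonian_weights_le_energy C T e (fun a => (odd a)%:R) (fun=> 1) e_sym ham.
  rewrite card_T (negPf n_even); under eq_bigr do rewrite sum1.
  rewrite sumr_const_nat subn0; apply => // a _; by rewrite sum1 mulr1.
have [k n_eq] : exists k, n = k.*2.+1.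
  by exists n./2; rewrite -[LHS]odd_double_half n_odd.
(* For [n = 1] the bound is 0; it is split off because [N - 1] is a divisor below. *)
case: k n_eq => [|k] n_eq.
  rewrite n_eq expr1n subrr sqrtC0; apply: sumr_ge0 => z _; exact: normr_ge0.
have n_gt1 : (1 < n)%N by rewrite n_eq.
have [N nE] : exists N : C, n%:R = N by exists n%:R.
have N1_gt0 : 0 < N - 1 by rewrite -nE subr_gt0 ltr1n.
have N2_gt0 : 0 < N + 1 by rewrite -nE addr_gt0 ?ltr01 // ltr0n (ltnW n_gt1).
have N1_neq0 := lt0r_neq0 N1_gt0; have N2_neq0 := lt0r_neq0 N2_gt0.
have NN : N ^+ 2 - 1 = (N - 1) * (N + 1) by ring.
have [t tE] : exists t, sqrtC (N ^+ 2 - 1) = t by exists (sqrtC (N ^+ 2 - 1)).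
have tt : t ^+ 2 = (N - 1) * (N + 1) by rewrite -tE sqrtCK NN.
have t_gt0 : 0 < t by rewrite -tE sqrtC_gt0 NN mulr_gt0.
rewrite nE tE.
(* The scaling factor is [1 / t]. Adjacent unscaled values add up to [n + 1] at odd positions and to
   [n - 1] at even ones, and both end values are 0 since [n] is odd. *)
pose d (a : nat) : C := t / ((N - 1) * (N + 1)) * (if odd a then (n - a)%N else a)%:R.
(* Chosen so that [M w = w] holds exactly, by [t ^+ 2 = (N - 1) * (N + 1)]. *)
pose w (b : bool) : C := if b then N + 1 else t.
have row a : (a < n)%N ->
    d a + d a.+1 = if odd a then t / (N - 1) else t / (N + 1).
  move=> a_lt; rewrite /d /=; case: (odd a) => /=.
    rewrite natrB 1?ltnW // -addn1 natrD nE; field.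
    by rewrite N1_neq0 N2_neq0.
  rewrite natrB // -addn1 natrD nE; field.
  by rewrite N1_neq0 N2_neq0.
(* There are [(n - 1) / 2] odd and [(n + 1) / 2] even positions, so each parity contributes
   [t / 2]. *)
have <- : \sum_(0 <= a < #|T|) (d a + d a.+1) = t.
  rewrite card_T; under eq_big_nat => a /andP[_ a_lt] do rewrite row //.
  rewrite n_eq sum_alternating -(mulr_natr _ k.+1) -(mulr_natr _ k.+2).
  have [K kE] : exists K : C, k.+1%:R = K by exists k.+1%:R.
  have NE : N = 1 + 2 * K by rewrite -nE n_eq -addn1 -muln2 natrD natrM kE; ring.
  rewrite -(addn1 k.+1) natrD kE.
  have -> : K = (N - 1) / 2 by rewrite NE; field.
  by field; rewrite N1_neq0 N2_neq0.
apply: (hamiltonian_weights_le_energy (w := w)) => //.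
- by rewrite /d mulr0.
- by rewrite card_T /d n_odd subnn mulr0.
- by move=> a _; rewrite /d mulr_ge0 ?ler0n // divr_ge0 ?(ltW t_gt0) // ltW // mulr_gt0.
- by case.
- move=> a; rewrite card_T => /row->; rewrite /w; case: (odd a) => /=.
    by rewrite mulrAC -expr2 tt mulrAC divff // mul1r.
  by rewrite divfK.
Qed.
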